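(* Let $K$ be a simplicial complex and let $a\in V(K)$ be a vertex that is locally dominated in $K$. If $K$ is a flag complex, then the induced subcomplex $\mathrm{Ind}_K(V(K)\setminus\{a\})$ is homotopy equivalent to $K$.
   Context: An (abstract) simplicial complex $K$ is a subset-closed collection of nonempty finite subsets (simplices) of its vertex set $V(K)$ (every vertex being a simplex); topological statements refer to geometric realizations. $K$ is a flag complex if a nonempty finite set $\sigma\subseteq V(K)$ is a simplex of $K$ if and only if each pair of vertices contained in $\sigma$ is a simplex of $K$. For $A\subseteq V(K)$, the induced subcomplex is $\mathrm{Ind}_K(A)=\{\sigma\in K \mid \sigma\subseteq A\}$. A vertex $a\in V(K)$ is locally dominated in $K$ if there exists a simplex $L_a\in K$ not containing $a$ such that for each $\sigma\in K$ with $a\in\sigma$ there exists $b_\sigma\in L_a$ with $\sigma\cup\{b_\sigma\}\in K$. *)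

(* Defs.v *)
From HB Require Import structures.
From mathcomp Require Import all_boot all_order all_algebra finmap.
From mathcomp Require Import boolp classical_sets functions set_interval reals.
From mathcomp Require Import topology normedtype.

Set Implicit Arguments.
Unset Strict Implicit.
Unset Printing Implicit Defensive.

Import Order.TTheory GRing.Theory Num.Theory.
Import numFieldNormedType.Exports.

Local Open Scope fset_scope.
Local Open Scope classical_set_scope.
Local Open Scope ring_scope.

(* The type [V] is only an ambient type: the vertex set V(K) is
   [vertices K], which need not be all of [V] and may be infinite. *)
Record simplicial_complex (V : choiceType) := SimplicialComplex {
  simplices :> {fset V} -> Prop;
  simplices_neq0 : forall s, simplices s -> s != fset0;
  simplices_sub : forall s t : {fset V},
    simplices s -> (t `<=` s)%fset -> t != fset0 -> simplices t
}.

Section complexes.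
Variables (V : choiceType).
Implicit Types (K : simplicial_complex V) (s t : {fset V}) (A : set V).

Definition vertices K : set V := [set v | K [fset v]%fset].

Definition flag K : Prop :=
  forall s, s != fset0 -> [set` s] `<=` vertices K ->
    (K s <-> forall u v, u \in s -> v \in s -> u != v -> K [fset u; v]%fset).

Lemma induced_neq0 K A s : (K s /\ [set` s] `<=` A) -> s != fset0.
Proof. by case=> /simplices_neq0. Qed.

Lemma induced_sub K A s t : (K s /\ [set` s] `<=` A) -> (t `<=` s)%fset ->
  t != fset0 -> K t /\ [set` t] `<=` A.
Proof.
move=> [Ks sA] ts t0; split; first exact: simplices_sub Ks ts t0.
by move=> v /= vt; apply: sA; apply: (fsubsetP ts).
Qed.

Definition induced K A : simplicial_complex V :=
  @SimplicialComplex V [set s | K s /\ [set` s] `<=` A]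
    (@induced_neq0 K A) (@induced_sub K A).

Definition locally_dominated K (a : V) : Prop :=
  exists L : {fset V}, [/\ K L, a \notin L &
    forall s, K s -> a \in s -> exists2 b, b \in L & K (b |` s)%fset].

End complexes.

(* Points of |K| are given by their barycentric coordinates. *)
Record realization (R : realType) (V : choiceType) (K : simplicial_complex V) :=
  Realization {
    coord :> {fsfun V -> R with 0};
    coord_simplex : K (finsupp coord);
    coord_ge0 : forall v, 0 <= coord v;
    coord_sum : \sum_(v <- finsupp coord) coord v = 1
  }.

Section realization_topology.
Variables (R : realType) (V : choiceType) (K : simplicial_complex V).
Local Notation X := (realization R K).

HB.instance Definition _ := gen_eqMixin X.
HB.instance Definition _ := gen_choiceMixin X.

Definition closed_simplex (s : {fset V}) : set X :=
  [set x | (finsupp (coord x) `<=` s)%fset].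

Definition coord_fun (x : X) : prod_topology (fun _ : V => R) := coord x.

(* Weak (coherent) topology: A is open iff its trace on every closed simplex
   is open there. The closed simplex on s carries its Euclidean topology,
   which is the one induced by the product topology since coordinates outside
   the finite set s vanish. *)
Definition realization_open (A : set X) : Prop :=
  forall s, K s -> exists2 O : set (prod_topology (fun _ : V => R)), open O &
    closed_simplex s `&` A = closed_simplex s `&` coord_fun @^-1` O.

Lemma realization_openT : realization_open setT.
Proof. by move=> s _; exists setT; [exact: openT|rewrite preimage_setT]. Qed.

Lemma realization_openI (A B : set X) :
  realization_open A -> realization_open B -> realization_open (A `&` B).
Proof.
move=> oA oB s Ks; have [O oO EO] := oA s Ks; have [P oP EP] := oB s Ks.
exists (O `&` P); first exact: openI.
by rewrite preimage_setI setIIr EO EP -setIIr.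
Qed.

Lemma realization_open_bigU (I : Type) (F : I -> set X) :
  (forall i, realization_open (F i)) -> realization_open (\bigcup_i F i).
Proof.
move=> oF s Ks; have /choice [O OP] : forall i,
    exists O : set (prod_topology (fun _ : V => R)), open O /\
    closed_simplex s `&` F i = closed_simplex s `&` coord_fun @^-1` O.
  by move=> i; have [O] := oF i s Ks; exists O.
exists (\bigcup_i O i); first by apply: bigcup_open => i _; have [] := OP i.
rewrite preimage_bigcup !setI_bigcupr.
by apply: eq_bigcupr => i _; have [] := OP i.
Qed.

HB.instance Definition _ := isOpenTopological.Build X
  realization_openT realization_openI realization_open_bigU.

Lemma open_realizationE (A : set X) : open A = realization_open A.
Proof. by []. Qed.

End realization_topology.

Section homotopy.
Variable R : realType.

Definition homotopic (X Y : topologicalType) (f g : X -> Y) : Prop :=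
  exists2 H : X * R -> Y,
    {within [set: X] `*` `[0, 1], continuous H} &
    forall x, H (x, 0) = f x /\ H (x, 1) = g x.

Definition homotopy_equivalent (X Y : topologicalType) : Prop :=
  exists (f : X -> Y) (g : Y -> X),
    [/\ continuous f, continuous g,
        homotopic (g \o f) idfun & homotopic (f \o g) idfun].

End homotopy.

(* Main.v *)
Require Import Defs.
From mathcomp Require Import all_boot all_order all_algebra finmap.
From mathcomp Require Import boolp classical_sets functions set_interval reals.
From mathcomp Require Import topology normedtype.
From mathcomp Require Import lra.

Set Implicit Arguments.
Unset Strict Implicit.
Unset Printing Implicit Defensive.

Import Order.TTheory GRing.Theory Num.Theory.
Import numFieldNormedType.Exports.

Local Open Scope classical_set_scope.
Local Open Scope ring_scope.

(** Each simplex containing a can be enlarged by a vertex of the simplex L, but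
the vertex depends on the simplex, so pushing the weight of a onto L cannot be
done simplexwise. The idea is to pass first to the truncation of a point x that
lowers every coordinate other than that of a by x_a (and cuts off at 0), and to
let a vertex b of L receive the weight max 0 (x_a - far_b x), where far_b x is
the total weight of the vertices other than b that no edge joins to b.

- The result lies in a simplex. If b receives weight and v survives the
  truncation, then x_v >= x_a > far_b x, so v is joined to b. The vertices in
  the support of x are joined to each other, and so are those of L; hence all
  edges of the new support are in K, and it is a simplex because K is flag
  ([flow_adj], [flow_simplex]).
- The total weight does not vanish. If x_a > 0, the support of x contains a,
  so some b in L spans a simplex with it; then far_b x = 0 and b receives x_a
  ([mass_gt0]).
- Where x_a = 0 nothing moves ([flow_id]), so after normalization this is a
  retraction of |K| onto the realization of the subcomplex without a.

[flow] is the deformation from this retraction (time 0) to the identity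
(time 1). Between times 1 and 1/2 only the truncation grows, within the support
of x; the weight of a is transferred to L between times 1/2 and 0, when the
truncation is complete.

Continuity has to be shown for the weak topology, and for the homotopy on the
product of |K| with R, where K need not be locally finite. Since a time interval
is compact, the tube lemma reduces the continuity of a map on this product to
that of its restrictions to a closed simplex times R
([continuous_realization_prod]); and a map into |K| that takes values in the
span of finitely many vertices is continuous when its coordinates are
([cvg_realization]). *)

(** * The weak topology, tested on closed simplices *)

Section realization_topology.
Variables (R : realType) (V : choiceType) (K : simplicial_complex V).
Local Notation X := (realization R K).
Implicit Types (x y : X) (s : {fset V}).

(** Traces on the closed simplex s of the neighbourhoods of x for the Euclidean
topology: the weak topology is the one that these filters generate jointly. *)
Definition simplex_nbhs s x : set_system X := fun P =>
  nbhs (coord_fun x)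
    [set c | forall y, closed_simplex s y -> coord_fun y = c -> P y].

#[global] Instance simplex_nbhs_filter s x : Filter (simplex_nbhs s x).
Proof.
split.
- by rewrite /simplex_nbhs; apply: filterE => c y.
- move=> P Q; rewrite /simplex_nbhs; apply: filterS2 => c Pc Qc y sy yc.
  by split; [exact: Pc|exact: Qc].
- by move=> P Q PQ; rewrite /simplex_nbhs; apply: filterS => c Pc y sy /(Pc y sy);
  exact: PQ.
Qed.

Lemma simplex_nbhs_point s x P : closed_simplex s x -> simplex_nbhs s x P -> P x.
Proof. by move=> sx /nbhs_singleton; exact. Qed.

Lemma simplex_nbhs_closed_simplex s x : simplex_nbhs s x (closed_simplex s).
Proof. by rewrite /simplex_nbhs; apply: filterE => c y. Qed.

Lemma coord_cvg s x v : y v @[y --> simplex_nbhs s x] --> x v.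
Proof.
move=> A Ax; have := @proj_continuous V (fun _ => R) v (coord_fun x) A Ax.
rewrite nbhs_filterE => vA; rewrite nbhs_filterE /simplex_nbhs /=.
apply: (@filterS _ (nbhs (coord_fun x)) _ _ _ _ vA) => c Ac y _ yc.
by move: Ac; rewrite -yc.
Qed.

Lemma open_simplex_nbhs (U : set X) :
  (forall s x, K s -> closed_simplex s x -> U x -> simplex_nbhs s x U) -> open U.
Proof.
move=> Uloc; rewrite open_realizationE => s Ks.
exists ([set c | forall y, closed_simplex s y -> coord_fun y = c -> U y]^°).
  exact: open_interior.
apply/seteqP; split=> x [sx Ux]; split=> //; first exact: Uloc.
have Uxx := nbhs_singleton Ux; exact: Uxx.
Qed.

Lemma cvg_coord_fun (T : Type) (F : set_system T) (FF : Filter F) (G : T -> X) x :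
  (forall v, G p v @[p --> F] --> x v) ->
  coord_fun (G p) @[p --> F] --> coord_fun x.
Proof.
move=> Gx; apply/cvg_sup => v A [_ [[B oB <-] Bx] BA].
have GB : F [set p | B (G p v)] by apply: Gx; exact: open_nbhs_nbhs.
by apply: (@filterS _ F _ _ _ _ GB) => p; exact: BA.
Qed.

(** The weak topology restricts to the Euclidean one on the span of finitely many
vertices: D has finitely many subsets s, and for each of them either x lies in
the closed simplex s, where openness is Euclidean, or some coordinate of x
outside s is nonzero and keeps the nearby values out of that closed simplex. *)
Lemma cvg_realization (T : Type) (F : set_system T) (FF : Filter F)
    (G : T -> X) x (D : {fset V}) :
  (\forall p \near F, (finsupp (G p) `<=` D)%fset) ->
  (forall v, G p v @[p --> F] --> x v) ->
  G p @[p --> F] --> x.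
Proof.
move=> GD Gx A; rewrite nbhsE => -[U [oU Ux] UA].
(* Openness of U at G p, one face s of the span of D at a time. *)
have face s : K s -> \forall p \near F, closed_simplex s (G p) -> U (G p).
  move=> Ks; have [sx|] := boolP (finsupp x `<=` s)%fset.
    have [O oO OE] : exists2 O : set (prod_topology (fun _ : V => R)), open O &
       closed_simplex s `&` U = closed_simplex s `&` @coord_fun _ _ K @^-1` O.
      exact: oU.
    have Ox : O (coord_fun x).
      by have [_] : (closed_simplex s `&` @coord_fun _ _ K @^-1` O) x by rewrite -OE.
    have : nbhs (coord_fun x) O by exact: open_nbhs_nbhs.
    move/(cvg_coord_fun FF Gx) => GO.
    apply: (@filterS _ F _ _ _ _ GO) => p Op sp.
    by have [] : (closed_simplex s `&` U) (G p) by rewrite OE.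
  case/fsubsetPn => v vx vs.
  have xv : x v != 0 by rewrite -mem_finsupp.
  have Gv := @cvgr_neq0 _ _ _ F FF _ _ (Gx v) xv.
  apply: filterS Gv => p /= pv /fsubsetP/(_ v).
  by rewrite mem_finsupp => /(_ pv); rewrite (negPf vs).
have : \forall p \near F, forall s, (s \in fpowerset D)%fset -> K s ->
    closed_simplex s (G p) -> U (G p).
  pose P s := [set p | K s -> closed_simplex s (G p) -> U (G p)].
  have FP s : s \in fpowerset D -> F (P s).
    move=> _; have [Ks|nK] := pselect (K s); last by apply: filterE => p /nK.
    by have := face s Ks; apply: filterS => p + _.
  apply: (@filterS _ F _ _ _ _ (@filter_bigI _ _ _ P F FF FP)) => p Pp s sD.
  exact: Pp.
apply: filterS2 GD => p pD Up; apply: UA; apply: (Up (finsupp (G p))) => //.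
- by rewrite fpowersetE.
- exact: coord_simplex.
- exact: fsubset_refl.
Qed.

Lemma continuous_realization (Z : topologicalType) (f : X -> Z) :
  (forall s x, K s -> closed_simplex s x -> f y @[y --> simplex_nbhs s x] --> f x) ->
  continuous f.
Proof.
move=> floc; apply/continuousP => U oU; apply: open_simplex_nbhs => s x Ks sx Ux.
by apply: floc => //; exact: open_nbhs_nbhs.
Qed.

(** The product of |K| with R carries the weak topology of the products of the
closed simplices with R. For a compact interval J, the points x such that H maps
{x} * J into the open set O form an open set W: on each closed simplex this is
the tube lemma. Then W * J is a neighbourhood in the product topology. *)
Lemma continuous_realization_prod (Z : topologicalType) (H : X * R -> Z) :
  (forall s x t, K s -> closed_simplex s x ->
     H p @[p --> filter_prod (simplex_nbhs s x) (nbhs t)] --> H (x, t)) ->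
  continuous H.
Proof.
move=> Hloc [x0 t0] B; rewrite nbhsE => -[O [oO Ox] OB].
have preim_nbhs s x t : K s -> closed_simplex s x -> O (H (x, t)) ->
    filter_prod (simplex_nbhs s x) (nbhs t) (H @^-1` O).
  by move=> Ks sx Oxt; apply: Hloc => //; exact: open_nbhs_nbhs.
have [[P Q] /= [Px Qt] PQ] :=
  preim_nbhs _ _ t0 (coord_simplex x0) (fsubset_refl _) Ox.
have {Px} Px : P x0 := simplex_nbhs_point (fsubset_refl _) Px.
have /nbhs_normP[e /= e0 eQ] := Qt.
pose J := `[t0 - e / 2, t0 + e / 2]%classic.
have JQ t : J t -> Q t.
  rewrite /J /= in_itv /= => /andP[t1 t2]; apply: eQ; move: t1 t2.
  rewrite /= distrC ltr_distl => t1 t2.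
  have e2 : e / 2 < e by rewrite ltr_pdivrMr// ltr_pMr// ltr1n.
  rewrite (le_lt_trans t2) ?ltrD2l// (lt_le_trans _ t1)// ltrD2l ltrN2 //.
pose W := [set x | forall t, J t -> O (H (x, t))].
have oW : open W.
  apply: open_simplex_nbhs => s x Ks sx Wx.
  have /compact_near_coveringP Jcover :=
    @segment_compact R (t0 - e / 2) (t0 + e / 2).
  have := Jcover X (simplex_nbhs s x) (fun y t => O (H (y, t))).
  apply => t Jt.
  have [[P' Q'] /= [P'x Q't] PQ'] := preim_nbhs _ _ _ Ks sx (Wx _ Jt).
  exists (Q', P') => // -[t' y] [/= Q't' P'y]; exact: (PQ' (y, t')).
have Wx0 : W x0 by move=> t Jt; apply: (PQ (x0, t)); split => //=; exact: JQ.
exists (W, J); first split => /=.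
- exact: open_nbhs_nbhs.
- apply: (@filterS _ _ _ `]t0 - e / 2, t0 + e / 2[%classic).
    exact: subset_itv_oo_cc.
  apply: open_nbhs_nbhs; split; first exact: itv_open.
  by rewrite /= in_itv /= ltrBlDr !ltrDl divr_gt0.
by move=> [x t] [/= Wx Jt]; apply: OB; exact: Wx.
Qed.

End realization_topology.

(** * Points with prescribed coordinates up to a scalar *)

Section points.
Variables (R : realType) (V : choiceType).

Lemma realization_eq (K : simplicial_complex V) (x y : realization R K) :
  (forall v, x v = y v) -> x = y.
Proof.
case: x y => [f f1 f2 f3] [g g1 g2 g3] /= /fsfunP fg.
by case: _ / fg in g1 g2 g3 *; congr Realization; exact: Prop_irrelevance.
Qed.

Lemma sum_coord (K : simplicial_complex V) (x : realization R K) (D : {fset V}) :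
  (finsupp x `<=` D)%fset -> \sum_(v <- D) x v = 1.
Proof.
move=> xD; rewrite -(coord_sum x); apply/esym/big_fset_incl => // v _.
by rewrite memNfinsupp => /eqP.
Qed.

Definition normalize (D : {fset V}) (u : V -> R) : {fsfun V -> R with 0} :=
  [fsfun v in D => u v / \sum_(w <- D) u w | 0].

Variables (K : simplicial_complex V) (D : {fset V}) (u : V -> R).
Hypothesis u_supp : forall v, v \notin D -> u v = 0.

Lemma normalizeE v : normalize D u v = u v / \sum_(w <- D) u w.
Proof. by rewrite fsfunE; case: ifPn => // /u_supp ->; rewrite mul0r. Qed.

Lemma normalize_supp : (finsupp (normalize D u) `<=` D)%fset.
Proof. exact: finsupp_sub. Qed.

Hypotheses (u_ge0 : forall v, 0 <= u v) (u_gt0 : 0 < \sum_(w <- D) u w).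

Lemma normalize_ge0 v : 0 <= normalize D u v.
Proof. by rewrite normalizeE divr_ge0 // ltW. Qed.

Lemma sum_normalize : \sum_(v <- finsupp (normalize D u)) normalize D u v = 1.
Proof.
rewrite (big_fset_incl _ normalize_supp) /=; last first.
  by move=> v _; rewrite memNfinsupp => /eqP.
under eq_bigr do rewrite normalizeE.
by rewrite -mulr_suml divff // gt_eqF.
Qed.

Definition normalized_point (uK : K (finsupp (normalize D u))) : realization R K :=
  Realization uK normalize_ge0 sum_normalize.

Lemma normalize_neq0 : finsupp (normalize D u) != fset0.
Proof.
apply/eqP => supp0; have := sum_normalize; rewrite supp0 big_seq_fset0 => /eqP.
by rewrite eq_sym oner_eq0.
Qed.

End points.

(** * Time schedules of the two stages of the deformation *)

Section time_schedules.
Variable R : realType.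

Definition clamp (r : R) : R := Num.max 0 (Num.min 1 r).

Lemma cvg_max0 (T : Type) (F : set_system T) (FF : Filter F) (f : T -> R) l :
  f p @[p --> F] --> l -> Num.max 0 (f p) @[p --> F] --> Num.max 0 l.
Proof.
move=> fl; apply: (cvg_comp _ (fun r : R => Num.max 0 r) fl).
apply: (@continuous_max R R (fun=> 0) id); [exact: cvg_cst|exact: cvg_id].
Qed.

Lemma clamp_continuous : continuous clamp.
Proof.
move=> r; apply: cvg_max0; apply: (@continuous_min R R (fun=> 1) id).
  exact: cvg_cst.
exact: cvg_id.
Qed.

Lemma clamp_ge0 r : 0 <= clamp r. Proof. by rewrite le_max lexx. Qed.
Lemma clamp_le1 r : clamp r <= 1.
Proof. by rewrite ge_max ler01 ge_min lexx. Qed.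

(** At time t, [trunc t] is the fraction of x_a taken off the other coordinates
and [push t] the fraction of x_a transferred to L. Time runs backwards, from the
identity at 1 to the retraction at 0. *)
Definition trunc (t : R) : R := clamp (2 - 2 * t).
Definition push (t : R) : R := clamp (1 - 2 * t).

Lemma trunc_continuous : continuous trunc.
Proof.
move=> t; apply: (@continuous_comp R R R (fun r => 2 - 2 * r) clamp);
  last exact: clamp_continuous.
by apply: cvgB; [exact: cvg_cst|apply: cvgM; [exact: cvg_cst|exact: cvg_id]].
Qed.

Lemma push_continuous : continuous push.
Proof.
move=> t; apply: (@continuous_comp R R R (fun r => 1 - 2 * r) clamp);
  last exact: clamp_continuous.
by apply: cvgB; [exact: cvg_cst|apply: cvgM; [exact: cvg_cst|exact: cvg_id]].
Qed.

(** The second stage starts only once the first is complete; otherwise the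
support of the moved point could fail to be a simplex. *)
Lemma push_gt0 t : 0 < push t -> trunc t = 1.
Proof.
rewrite /push /trunc /clamp lt_max ltxx /= lt_min ltr01 /= => t_small.
have t_le : 1 <= 2 - 2 * t by lra.
by rewrite (min_l t_le) max_r.
Qed.

Lemma push0 : push 0 = 1.
Proof. by rewrite /push /clamp mulr0 subr0 minxx max_r. Qed.

Lemma push1 : push 1 = 0.
Proof. by rewrite /push /clamp mulr1 min_r ?max_l //; lra. Qed.

Lemma trunc1 : trunc 1 = 0.
Proof. by rewrite /trunc /clamp mulr1 subrr min_r ?max_l. Qed.

End time_schedules.

(** * The deformation *)

Section flow.
Variables (R : realType) (V : choiceType) (K : simplicial_complex V).
Variables (a : V) (L : {fset V}).
Local Notation X := (realization R K).
Implicit Types (x y : X) (t : R) (u v w b : V).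

(** Every vertex of K is adjacent to itself, so that no case of equal vertices
arises below. *)
Definition adj u v := `[< K [fset u; v]%fset >].

(** In a flag complex with vertex b this vanishes exactly on the closed star of
b. *)
Definition far b x : R := \sum_(v <- finsupp x | ~~ adj v b) x v.

Definition flow t x v : R :=
  if v == a then (1 - push t) * x a
  else Num.max 0 (x v - trunc t * x a)
       + (v \in L)%:R * push t * Num.max 0 (x a - far v x).

Definition flow_dom x := (finsupp x `|` L)%fset.
Definition mass t x := \sum_(v <- flow_dom x) flow t x v.

Lemma adjC u v : adj u v = adj v u.
Proof. by rewrite /adj fsetUC. Qed.

Lemma adj_simplex s u v : K s -> u \in s -> v \in s -> adj u v.
Proof.
move=> Ks us vs; apply/asboolP; apply: (simplices_sub Ks).
  by apply/fsubsetP => w; rewrite !inE => /orP[]/eqP->.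
by apply/fset0Pn; exists u; rewrite !inE eqxx.
Qed.

(** On a closed simplex the index set can be fixed, which makes the continuity of
[far] there that of a finite sum. *)
Lemma farE b x s : (finsupp x `<=` s)%fset ->
  far b x = \sum_(v <- s | ~~ adj v b) x v.
Proof.
move=> xs; rewrite /far big_mkcond [RHS]big_mkcond /=.
apply: big_fset_incl => // v _; rewrite memNfinsupp => /eqP ->.
by rewrite if_same.
Qed.

Lemma far_ge0 b x : 0 <= far b x.
Proof. by apply: sumr_ge0 => v _; exact: coord_ge0. Qed.

Lemma far_ge b x v : ~~ adj v b -> x v <= far b x.
Proof.
move=> vb; have [vx|] := boolP (v \in finsupp x); last first.
  by rewrite memNfinsupp => /eqP ->; exact: far_ge0.
rewrite /far big_mkcond (big_fsetD1 v) //= vb lerDl.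
by apply: sumr_ge0 => w _; case: ifP => // _; exact: coord_ge0.
Qed.

Lemma far_eq0 b x s : K s -> b \in s -> (finsupp x `<=` s)%fset -> far b x = 0.
Proof.
move=> Ks bs /fsubsetP xs; rewrite /far big_seq_cond big1 // => v /andP[vx].
by rewrite (adj_simplex Ks) // xs.
Qed.

Lemma flow_ge0 t x v : 0 <= flow t x v.
Proof.
rewrite /flow; case: ifP => _.
  by rewrite mulr_ge0 ?coord_ge0 // subr_ge0 clamp_le1.
by rewrite addr_ge0 ?le_max ?lexx // !mulr_ge0 ?clamp_ge0 ?ler0n ?le_max ?lexx.
Qed.

Lemma flow_id t x v : x a = 0 -> flow t x v = x v.
Proof.
move=> xa; rewrite /flow xa !mulr0 subr0; case: eqP => [->|_] //.
rewrite max_r ?coord_ge0 // [Num.max _ _]max_l ?mulr0 ?addr0 //.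
by rewrite sub0r oppr_le0 far_ge0.
Qed.

Lemma flow1 x v : flow 1 x v = x v.
Proof.
rewrite /flow push1 trunc1 !mul0r mulr0 mul0r subr0 mul1r subr0 addr0.
by case: eqP => [->//|_]; rewrite max_r ?coord_ge0.
Qed.

Lemma flow0a x : flow 0 x a = 0.
Proof. by rewrite /flow eqxx push0 subrr mul0r. Qed.

(** The two sources of a nonzero coordinate: a vertex of x that survives the
truncation, or a vertex of L that receives weight. The inequalities are what
makes a vertex of the first kind adjacent to one of the second. *)
Lemma flow_neq0 t x v : flow t x v != 0 ->
  (v \in finsupp x /\ trunc t * x a <= x v) \/
  [/\ v \in L, 0 < push t & far v x < x a].
Proof.
rewrite /flow; have [->|_ fv] := eqVneq v a.
  rewrite mulf_eq0 negb_or mem_finsupp => /andP[_ xa]; left; split=> //.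
  by rewrite ler_piMl ?coord_ge0 ?clamp_le1.
have [vx|xv] := ltP (trunc t * x a) (x v).
  left; split; last exact: ltW.
  rewrite mem_finsupp gt_eqF //.
  by rewrite (le_lt_trans _ vx) // mulr_ge0 ?coord_ge0 ?clamp_ge0.
right; move: fv; rewrite max_l ?subr_le0 // add0r !mulf_eq0 !negb_or.
case: (v \in L) => /=; last by rewrite eqxx.
rewrite oner_eq0 /= => /andP[t0 xv0]; split=> //.
  by rewrite lt_def t0 clamp_ge0.
by rewrite ltNge -subr_le0; apply: contra xv0 => ?; rewrite max_l.
Qed.

Lemma flow_supp t x v : v \notin flow_dom x -> flow t x v = 0.
Proof.
rewrite inE negb_or => /andP[vx vL]; apply/eqP; apply: contraT => /flow_neq0.
by case=> [[]|[]]; rewrite ?(negPf vx) ?(negPf vL).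
Qed.

Lemma mass1 x : mass 1 x = 1.
Proof.
rewrite /mass; under eq_bigr do rewrite flow1.
exact/sum_coord/fsubsetUl.
Qed.

Hypotheses (flagK : flag K) (KL : K L) (aL : a \notin L).
Hypothesis dominating :
  forall s, K s -> a \in s -> exists2 b, b \in L & K (b |` s)%fset.

(** This is where local domination is used. As long as [push t] < 1, the vertex a
keeps weight if it had any. At the end, a vertex b of L spanning a simplex with
the whole support of x satisfies far b x = 0 and has received all of x_a. *)
Lemma mass_gt0 t x : 0 < mass t x.
Proof.
suff [v fv] : exists v, 0 < flow t x v.
  have vD : v \in flow_dom x.
    by apply: contraLR fv => /flow_supp ->; rewrite ltxx.
  rewrite /mass (big_fsetD1 v) //= ltr_pwDl // sumr_ge0 // => w _.
  exact: flow_ge0.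
have [xa|xa] := eqVneq (x a) 0.
  have /fset0Pn[v vx] := simplices_neq0 (coord_simplex x).
  exists v; rewrite flow_id // lt_def coord_ge0 andbT.
  by move: vx; rewrite mem_finsupp.
have xa0 : 0 < x a by rewrite lt_def xa coord_ge0.
have [pt|pt] := eqVneq (push t) 1; last first.
  by exists a; rewrite /flow eqxx mulr_gt0 // subr_gt0 lt_neqAle pt clamp_le1.
have [b bL Kb] : exists2 b, b \in L & K (b |` finsupp x)%fset.
  by apply: dominating; rewrite ?mem_finsupp //; exact: coord_simplex.
(* Now [push t] is 1 and b receives all of x_a; a itself is not in L. *)
exists b; rewrite /flow; case: eqP => [ba|_]; first by move: aL; rewrite -ba bL.
rewrite ltr_wpDl ?le_max ?lexx // bL pt !mul1r (far_eq0 Kb) ?fsetU11 ?fsubsetUr //.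
by rewrite subr0 lt_max xa0 orbT.
Qed.

(** If v receives weight, the truncation is complete, so that a surviving u has
x_u >= x_a > far v x; a vertex not adjacent to v weighs at most far v x. *)
Lemma flow_adj t x u v : flow t x u != 0 -> flow t x v != 0 -> adj u v.
Proof.
have mixed u' v' : 0 < push t -> far v' x < x a ->
    trunc t * x a <= x u' -> adj u' v'.
  move=> /push_gt0 -> xv; rewrite mul1r => xu; apply: contraT => /far_ge.
  by move=> /(_ x) /(le_trans xu); rewrite leNgt xv.
move=> /flow_neq0[[ux u1]|[uL pt u1]] /flow_neq0[[vx v1]|[vL pt' v1]].
- exact: adj_simplex (coord_simplex x) ux vx.
- exact: mixed.
- by rewrite adjC; exact: mixed.
- exact: adj_simplex KL uL vL.
Qed.

Lemma flow_simplex t x : K (finsupp (normalize (flow_dom x) (flow t x))).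
Proof.
have supp v : v \in finsupp (normalize (flow_dom x) (flow t x)) -> flow t x v != 0.
  rewrite mem_finsupp normalizeE; last exact: flow_supp.
  by apply: contraNneq => ->; rewrite mul0r.
have edge u v : u \in finsupp (normalize (flow_dom x) (flow t x)) ->
    v \in finsupp (normalize (flow_dom x) (flow t x)) -> K [fset u; v]%fset.
  by move=> /supp u0 /supp v0; apply/asboolP/(flow_adj u0 v0).
apply/flagK.
- apply: normalize_neq0 (mass_gt0 t x); [exact: flow_supp].
- by move=> v vN; rewrite /vertices /= -(fsetUid [fset v]%fset); exact: edge.
- by move=> u v uN vN _; exact: edge.
Qed.

Definition flow_point (p : X * R) : X :=
  normalized_point (@flow_supp p.2 p.1) (flow_ge0 p.2 p.1) (mass_gt0 p.2 p.1)
    (flow_simplex p.2 p.1).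

Lemma flow_pointE x t v : flow_point (x, t) v = flow t x v / mass t x.
Proof. by rewrite /= normalizeE //; exact: flow_supp. Qed.

Lemma retract_simplex x :
  induced K (vertices K `\ a) (finsupp (normalize (flow_dom x) (flow 0 x))).
Proof.
have KT := flow_simplex 0 x; split=> // v /= vT; split.
  rewrite /vertices /= -(fsetUid [fset v]%fset).
  by apply/asboolP/(adj_simplex KT).
move=> va; move: vT; rewrite va mem_finsupp normalizeE; last exact: flow_supp.
by rewrite flow0a mul0r eqxx.
Qed.

Definition retract x : realization R (induced K (vertices K `\ a)) :=
  normalized_point (@flow_supp 0 x) (flow_ge0 0 x) (mass_gt0 0 x)
    (retract_simplex x).

Lemma retractE x v : retract x v = flow 0 x v / mass 0 x.
Proof. by rewrite /= normalizeE //; exact: flow_supp. Qed.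

Section flow_continuity.
Variables (s : {fset V}) (x : X) (t : R).
Hypothesis sx : closed_simplex s x.
Local Notation F := (filter_prod (simplex_nbhs s x) (nbhs t)).

Lemma near_closed_simplex : \forall p \near F, closed_simplex s p.1.
Proof. exact: cvg_fst (@simplex_nbhs_closed_simplex _ _ _ s x). Qed.

Lemma cvg_coord v : (p.1 : X) v @[p --> F] --> x v.
Proof.
move=> A vA.
apply: (@cvg_fst X R (simplex_nbhs s x) (nbhs t) _ [set y : X | A (y v)]).
exact: (coord_cvg s vA).
Qed.

Lemma cvg_time (f : R -> R) : continuous f -> f p.2 @[p --> F] --> f t.
Proof.
move=> cf A fA; apply: (@cvg_snd X R (simplex_nbhs s x) (nbhs t) _ (f @^-1` A)).
exact: cf.
Qed.

Lemma cvg_sum_seq (r : seq V) (P : pred V) (f : V -> X * R -> R) (l : V -> R) :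
  (forall v, f v p @[p --> F] --> l v) ->
  \sum_(v <- r | P v) f v p @[p --> F] --> \sum_(v <- r | P v) l v.
Proof. by move=> fl; apply: (cvg_big (@add_continuous R)) => v _; exact: fl. Qed.

Lemma cvg_far b : far b p.1 @[p --> F] --> far b x.
Proof.
rewrite (farE b sx); apply: cvg_trans; last first.
  exact: (@cvg_sum_seq s (fun v => ~~ adj v b) (fun v p => (p.1 : X) v) x cvg_coord).
apply: near_eq_cvg; apply: filterS near_closed_simplex => p sp.
by rewrite -(farE b sp).
Qed.

Lemma cvg_flow v : flow p.2 p.1 v @[p --> F] --> flow t x v.
Proof.
rewrite /flow; case: ifP => _.
  apply: cvgM; last exact: cvg_coord.
  by apply: cvgB; [exact: cvg_cst|exact/cvg_time/push_continuous].
apply: cvgD.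
  apply: cvg_max0; apply: cvgB; first exact: cvg_coord.
  by apply: cvgM; [exact/cvg_time/trunc_continuous|exact: cvg_coord].
apply: cvgM.
  by apply: cvgM; [exact: cvg_cst|exact/cvg_time/push_continuous].
by apply: cvg_max0; apply: cvgB; [exact: cvg_coord|exact: cvg_far].
Qed.

Lemma massE r y : closed_simplex s y ->
  mass r y = \sum_(v <- (s `|` L)%fset) flow r y v.
Proof.
move=> sy; apply: big_fset_incl; first exact: fsetSU.
by move=> v _; exact: flow_supp.
Qed.

Lemma cvg_mass : mass p.2 p.1 @[p --> F] --> mass t x.
Proof.
rewrite (massE t sx); apply: cvg_trans; last first.
  exact: (@cvg_sum_seq (s `|` L)%fset xpredT (fun v p => flow p.2 p.1 v) _ cvg_flow).
apply: near_eq_cvg; apply: filterS near_closed_simplex => p sp.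
by rewrite -(massE _ sp).
Qed.

Lemma cvg_normalized_flow v :
  flow p.2 p.1 v / mass p.2 p.1 @[p --> F] --> flow t x v / mass t x.
Proof.
apply: cvgM; first exact: cvg_flow.
by apply: cvgV; [rewrite gt_eqF // mass_gt0|exact: cvg_mass].
Qed.

End flow_continuity.

Lemma flow_point_continuous : continuous flow_point.
Proof.
apply: continuous_realization_prod => s x t Ks sx.
apply: (@cvg_realization _ _ _ _ _ _ _ _ (s `|` L)%fset).
  apply: filterS (near_closed_simplex s x t) => p sp.
  by apply: fsubset_trans (normalize_supp _ _) _; exact: fsetSU.
move=> v; rewrite flow_pointE; under eq_cvg do rewrite [_ v]flow_pointE.
exact: cvg_normalized_flow.
Qed.

Lemma retract_continuous : continuous retract.
Proof.
apply: continuous_realization => s x Ks sx.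
apply: (@cvg_realization _ _ _ _ _ _ _ _ (s `|` L)%fset).
  apply: filterS (@simplex_nbhs_closed_simplex _ _ _ s x) => y sy.
  by apply: fsubset_trans (normalize_supp _ _) _; exact: fsetSU.
move=> v; rewrite retractE; under eq_cvg do rewrite [_ v]retractE.
move=> A fA; have [[P Q] /= [Px Q0] PQ] := @cvg_normalized_flow s x 0 sx v A fA.
apply: (@filterS _ (simplex_nbhs s x) _ P) Px => y Py.
by apply: (PQ (y, 0)); split=> //=; exact: nbhs_singleton Q0.
Qed.

End flow.

(** * Subcomplexes and the homotopy equivalence *)

Section inclusion.
Variables (R : realType) (V : choiceType) (K K' : simplicial_complex V).
Hypothesis K'K : forall s, K' s -> K s.

Definition inclusion (x : realization R K') : realization R K :=
  Realization (K'K (coord_simplex x)) (coord_ge0 x) (coord_sum x).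

Lemma inclusion_continuous : continuous inclusion.
Proof.
apply: continuous_realization => s x Ks sx.
apply: (@cvg_realization _ _ _ _ _ _ _ _ s).
  exact: simplex_nbhs_closed_simplex.
by move=> v; exact: coord_cvg.
Qed.

End inclusion.

Theorem theorem3p4 (R : realType) (V : choiceType) (K : simplicial_complex V)
    (a : V) (aK : vertices K a) (dom_a : locally_dominated K a)
    (flagK : flag K) :
  homotopy_equivalent R
    (realization R (induced K (vertices K `\ a)%classic))
    (realization R K).
Proof.
have [L [KL aL dominating]] := dom_a.
have K'K s : induced K (vertices K `\ a)%classic s -> K s by case.
pose i := @inclusion R V K _ K'K.
pose r := @retract R V K a L flagK KL aL dominating.
exists i, r; split.
- exact: inclusion_continuous.
- exact: retract_continuous.
- have ri x : (r \o i) x = x.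
    apply: realization_eq => v; rewrite /= (retractE flagK KL aL dominating).
    have xa : i x a = 0.
      apply/eqP; rewrite -memNfinsupp; apply/negP => ax.
      by have [_ /(_ a ax)[_]] := coord_simplex x; exact.
    rewrite flow_id // /mass; under eq_bigr do rewrite flow_id //.
    by rewrite (@sum_coord _ _ _ (i x)) ?fsubsetUl // divr1.
  (* [r] retracts onto the subcomplex, so the constant homotopy will do. *)
  exists (fun p => p.1) => [|x]; last by rewrite ri.
  by apply: continuous_subspaceT => p; exact: cvg_fst.
- exists (flow_point flagK KL aL dominating) => [|x].
    exact/continuous_subspaceT/flow_point_continuous.
  split; apply: realization_eq => v; rewrite flow_pointE.
    by rewrite -(retractE flagK KL aL dominating).
  by rewrite mass1 flow1 divr1.
Qed.
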